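(* Let $T$ be a tree. For $i\in\{0,1,2\}$, let $E_i\subseteq E(T)$ be such that every edge of $E_i$ is incident with exactly $i$ vertices whose degree in $T$ is at most $2$. Then for every $k$ with $\frac13\le k\le\frac12$, the graph $T-(E_0\cup E_1\cup E_2)$ has at least $1+k|E_0|+(1-k)|E_1|+|E_2|$ components that contain a vertex whose degree in $T$ is at most $2$.
   Context: $T-E$ denotes the spanning subgraph of $T$ obtained by deleting the edge set $E$ (keeping all vertices). *)

(* Defs.v *)
From mathcomp Require Import all_boot all_order all_algebra.

Set Implicit Arguments.
Unset Strict Implicit.
Unset Printing Implicit Defensive.

(* A finite simple graph is a symmetric irreflexive relation [g : rel V] on a
   finite type; its edges are the two-element sets [set x; y] with [g x y]. *)
Section Graphs.

Variables (V : finType) (g : rel V).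

Definition simple_graph : Prop := symmetric g /\ irreflexive g.

Definition edges : {set {set V}} :=
  [set f | [exists x, exists y, g x y && (f == [set x; y])]].

Definition degree (x : V) : nat := #|[set y | g x y]|.

Definition connected_graph : Prop :=
  (exists x : V, True) /\ forall x y : V, connect g x y.

(* [ucycle] also accepts sequences of length at most 2, which are not graph
   cycles. *)
Definition acyclic : Prop :=
  forall c : seq V, 3 <= size c -> ~ ucycle g c.

Definition tree : Prop := [/\ simple_graph, connected_graph & acyclic].

Definition del_edges (E : {set {set V}}) : rel V :=
  fun x y => g x y && ([set x; y] \notin E).

Definition components : {set {set V}} :=
  [set [set y | connect g x y] | x : V].

Definition low_degree : {set V} := [set x | degree x <= 2].

End Graphs.

(* Main.v *)
Require Import Defs.
From mathcomp Require Import all_boot all_order all_algebra.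
From mathcomp Require Import zify lra.

(** Let F be the set of deleted edges and call a component of T - F bad if all
    its vertices have degree at least 3. Since T - F has at least 1 + |F|
    components, it is enough that b <= (1 - k)|E0| + k|E1| for the number b of
    bad ones. Let B be the union of the bad components. The degrees in T of its
    vertices add up to at least 3|B|. A forest with c components meeting B has
    at most |B| - c edges inside B: deleting these edges creates as many
    components as there are edges, and afterwards at most |B| components meet
    B. So T - F has at most |B| - b edges inside B, and T at most |B|. Hence
    the edges of F have at least |B| + 2b >= 3b ends in B, which gives
    3b <= 2|E0| + |E1|, and at least |B| + b >= 2b of them meet B, which gives
    2b <= |E0| + |E1|. Combining these bounds with the weights 1 - 2k and
    3k - 1, nonnegative for 1/3 <= k <= 1/2, gives the bound on b. *)

Set Implicit Arguments.
Unset Strict Implicit.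
Unset Printing Implicit Defensive.

Import Order.TTheory GRing.Theory Num.Theory.
Local Open Scope ring_scope.

Section Graphs.

Local Open Scope nat_scope.

Variable V : finType.
Implicit Types (g h : rel V) (B C : {set V}) (F P : {set {set V}}).

Lemma edgesP g f :
  reflect (exists x y, g x y /\ f = [set x; y]) (f \in edges g).
Proof.
rewrite inE; apply: (iffP existsP) => [[x /existsP[y /andP[gxy /eqP->]]]|].
  by exists x, y.
by case=> x [y [gxy ->]]; exists x; apply/existsP; exists y; rewrite gxy eqxx.
Qed.

Lemma mem_edges g x y : g x y -> [set x; y] \in edges g.
Proof. by move=> gxy; apply/edgesP; exists x, y. Qed.

Lemma card_edge g f : simple_graph g -> f \in edges g -> #|f| = 2.
Proof.
case=> _ gI /edgesP[x [y [gxy ->]]]; rewrite cards2.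
by case: eqP gxy => // ->; rewrite gI.
Qed.

Lemma simple_del_edges g F : simple_graph g -> simple_graph (del_edges g F).
Proof.
case=> gC gI; split=> [x y|x]; last by rewrite /del_edges gI.
by rewrite /del_edges gC setUC.
Qed.

Lemma acyclic_del_edges g F : acyclic g -> acyclic (del_edges g F).
Proof.
move=> acg c szc /andP[hc uc]; apply: (acg c szc); rewrite /ucycle uc andbT.
by apply: sub_cycle hc => x y /andP[].
Qed.

Lemma edges_del_edges g F : edges (del_edges g F) = edges g :\: F.
Proof.
apply/setP => f; rewrite in_setD.
apply/edgesP/andP => [[x [y [/andP[gxy nF] ->]]]|].
  by rewrite nF mem_edges.
case=> nF /edgesP[x [y [gxy def_f]]]; exists x, y.
by rewrite /del_edges gxy -def_f.
Qed.

Lemma del_edges0 g : del_edges g set0 =2 g.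
Proof. by move=> x y; rewrite /del_edges inE andbT. Qed.

Lemma del_edgesU g F1 F2 :
  del_edges (del_edges g F1) F2 =2 del_edges g (F1 :|: F2).
Proof. by move=> x y; rewrite /del_edges inE negb_or andbA. Qed.

Lemma degreeE g x :
  simple_graph g -> degree g x = #|[set f in edges g | x \in f]|.
Proof.
case=> gC gI; rewrite /degree -(@card_in_imset _ _ (fun y => [set x; y])).
  congr #|pred_of_set _|; apply/setP => f; rewrite inE; apply/imsetP/andP.
    by case=> y; rewrite inE => gxy ->; rewrite mem_edges ?set21.
  case=> /edgesP[u [v [guv ->]]]; rewrite !inE => /orP[]/eqP->.
    by exists v; rewrite ?inE.
  by exists u; rewrite ?inE 1?gC // setUC.
move=> y z; rewrite !inE => gxy gxz /setP/(_ y); rewrite !inE eqxx orbT.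
by case: eqP => [yx|_ /esym/eqP //]; rewrite yx gI in gxy.
Qed.

Lemma sum_degree g B : simple_graph g ->
  \sum_(x in B) degree g x = \sum_(f in edges g) #|f :&: B|.
Proof.
move=> sg; under eq_bigr => x _ do rewrite degreeE // -sum1_card.
under [RHS]eq_bigr => f _ do rewrite -sum1_card.
rewrite (exchange_big_dep (mem (edges g))) /=; last first.
  by move=> x f _; rewrite inE => /andP[].
apply: eq_bigr => f fE; apply: eq_bigl => x; move: fE.
by rewrite !inE => ->; rewrite andbC.
Qed.

Definition edges_within g B := [set f in edges g | f \subset B].

Lemma card_edges_within_del_edges g F B : F \subset edges g ->
  #|edges_within g B|
    = #|[set f in F | f \subset B]| + #|edges_within (del_edges g F) B|.
Proof.
move=> FE; rewrite -(cardsID F) /edges_within edges_del_edges !setIdE.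
by rewrite setIAC (setIidPr FE) setIDAC.
Qed.

Lemma sum_degree_closed g B : simple_graph g -> closed g B ->
  \sum_(x in B) degree g x = 2 * #|edges_within g B|.
Proof.
move=> sg clB; rewrite sum_degree // mulnC -sum_nat_const.
rewrite [RHS](eq_bigl (fun f => (f \in edges g) && (f \subset B))); last first.
  by move=> f; rewrite inE.
rewrite big_mkcondr; apply: eq_bigr => f fE /=; have f2 := card_edge sg fE.
have /edgesP[x [y [gxy def_f]]] := fE.
have [fB|] := boolP (f \subset B); first by rewrite (setIidPl fB).
rewrite def_f subUset !sub1set -(clB _ _ gxy) andbb => nBx; apply/eqP.
rewrite cards_eq0 setI_eq0 disjoints_subset subUset !sub1set !inE.
by rewrite -(clB _ _ gxy) nBx.
Qed.

Definition component g x := [set y | connect g x y].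

Lemma component_refl g x : x \in component g x.
Proof. by rewrite inE. Qed.

Lemma mem_components g x : component g x \in components g.
Proof. exact: imset_f. Qed.

Lemma eq_component g x y :
  symmetric g -> connect g x y -> component g x = component g y.
Proof.
move=> gC gxy; apply/setP => z.
by rewrite !inE (same_connect (sym_connect_sym gC) gxy).
Qed.

Lemma eq_components g h : g =2 h -> components g = components h.
Proof.
move=> gh; apply: eq_imset => x; apply/setP => y.
by rewrite !inE (eq_connect gh).
Qed.

Lemma ltn_card_components g h x y : symmetric g -> subrel h g ->
  connect g x y -> ~~ connect h x y -> #|components g| < #|components h|.
Proof.
move=> gC hg gxy nhxy.
have sub_connect : subrel (connect h) (connect g).
  by apply: connect_sub => u v /hg/connect1.
pose enlarge C := [set v | [exists u in C, connect g u v]].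
have enlarge_component u : enlarge (component h u) = component g u.
  apply/setP => v; rewrite !inE; apply/exists_inP/idP => [[w]|guv].
    by rewrite inE => /sub_connect; apply: connect_trans.
  by exists u; rewrite ?component_refl.
have -> : components g = enlarge @: components h.
  rewrite /components -imset_comp; apply: eq_imset => u.
  exact/esym/enlarge_component.
rewrite ltn_neqAle leq_imset_card andbT; apply: contra nhxy => /imset_injP inj.
suff /setP/(_ y) : component h x = component h y by rewrite !inE connect0.
apply: inj; rewrite ?mem_components ?enlarge_component //.
exact: eq_component.
Qed.

Lemma acyclic_bridge g x y : simple_graph g -> acyclic g -> g x y ->
  ~~ connect (del_edges g [set [set x; y]]) x y.
Proof.
case=> gC gI acg gxy; apply/negP => /connectP[p hp lastp].
case/shortenP: hp lastp => p' hp' uniq_p _ lastp.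
apply: (acg (x :: p')); last first.
  rewrite /ucycle uniq_p andbT /= rcons_path -lastp gC gxy andbT.
  by apply: sub_path hp' => u v /andP[].
case: p' hp' lastp {uniq_p} => [|z [|//]] /=.
  by move=> _ yx; rewrite yx gI in gxy.
by rewrite andbT => /andP[_ /[swap] <-]; rewrite inE eqxx.
Qed.

Lemma leq_card_components_del_edges g F : simple_graph g -> acyclic g ->
  F \subset edges g -> #|components g| + #|F| <= #|components (del_edges g F)|.
Proof.
have [n] := ubnP #|F|; elim: n F g => // n IHn F g ltFn sg acg FE.
have [->|[f fF]] := set_0Vmem F.
  by rewrite cards0 addn0 (eq_components (del_edges0 g)).
have /edgesP[x [y [gxy def_f]]] := subsetP FE _ fF; have [gC _] := sg.
pose g' := del_edges g [set f].
have FE' : F :\ f \subset edges g' by rewrite edges_del_edges setSD.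
have cardF : #|F| = #|F :\ f|.+1 by rewrite (cardsD1 f) fF.
have split_f : #|components g| < #|components g'|.
  apply: (@ltn_card_components _ _ x y) => //; [by move=> u v /andP[]| |].
    exact: connect1.
  by rewrite /g' def_f acyclic_bridge.
have := IHn (F :\ f) g' _ (simple_del_edges _ sg) (acyclic_del_edges acg) FE'.
rewrite (eq_components (del_edgesU _ _ _)) setD1K //.
by lia.
Qed.

Lemma ltn_card_components_tree_del_edges g F :
  tree g -> F \subset edges g -> #|F| < #|components (del_edges g F)|.
Proof.
case=> sg [[x _] _] acg FE.
apply: leq_trans (leq_card_components_del_edges sg acg FE).
rewrite -add1n leq_add2r; apply/card_gt0P.
by exists (component g x); apply: mem_components.
Qed.

Definition components_meeting g B := [set C in components g | C :&: B != set0].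

Definition components_avoiding g B := [set C in components g | C :&: B == set0].

Lemma card_components_meeting_avoiding g B :
  #|components_meeting g B| + #|components_avoiding g B| = #|components g|.
Proof.
rewrite -(cardsID [set C | C :&: B != set0] (components g)).
congr (_ + _); apply: eq_card => C; rewrite !inE //.
by rewrite negbK andbC.
Qed.

Lemma disjoint_cover_components_avoiding g B :
  [disjoint cover (components_avoiding g B) & B].
Proof.
rewrite disjoints_subset; apply/bigcupsP => C; rewrite inE => /andP[_ CB].
by rewrite -disjoints_subset -setI_eq0.
Qed.

Lemma sub_components_del_edges_within g B : symmetric g ->
  components (del_edges g (edges_within g B))
    \subset component (del_edges g (edges_within g B)) @: B
             :|: components_avoiding g B.
Proof.
set h := del_edges g _ => gC; have hC : symmetric h.
  by move=> x y; rewrite /h /del_edges gC setUC.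
apply/subsetP => C /imsetP[x _ ->]; rewrite -/(component h x) in_setU.
have [CB0|/set0Pn[y]] := eqVneq (component h x :&: B) set0; last first.
  rewrite in_setI inE => /andP[hxy yB].
  by rewrite (eq_component hC hxy) imset_f.
suff component_hg : component h x = component g x.
  by rewrite component_hg in CB0 *; rewrite inE CB0 eqxx mem_components orbT.
have closed_h : closed g [in component h x].
  apply: (intro_closed (sym_connect_sym gC)) => u v guv xu.
  have nuB : u \notin B.
    by apply/negP => uB; have := in_set0 u; rewrite -CB0 in_setI xu uB.
  move: xu; rewrite !inE => /connect_trans; apply; apply: connect1.
  by rewrite /h /del_edges guv inE subUset !sub1set (negbTE nuB) andbF.
apply/eqP; rewrite eqEsubset; apply/andP; split; apply/subsetP => y.
  by rewrite !inE; apply: connect_sub => u v /andP[guv _]; apply: connect1.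
by rewrite inE => /(closed_connect closed_h) <-; apply: component_refl.
Qed.

Lemma leq_card_components_meeting g B : simple_graph g -> acyclic g ->
  #|components_meeting g B| + #|edges_within g B| <= #|B|.
Proof.
move=> sg acg; have [gC _] := sg; set h := del_edges g (edges_within g B).
have lower : #|components g| + #|edges_within g B| <= #|components h|.
  apply: leq_card_components_del_edges => //.
  by rewrite /edges_within setIdE subsetIl.
have upper : #|components h| <= #|B| + #|components_avoiding g B|.
  apply: leq_trans (subset_leq_card (sub_components_del_edges_within B gC)) _.
  by apply: leq_trans (leq_card_setU _ _) _; rewrite leq_add2r leq_imset_card.
by have := card_components_meeting_avoiding g B; lia.
Qed.

Lemma closed_cover_components g P :
  symmetric g -> P \subset components g -> closed g (cover P).
Proof.
move=> gC /subsetP PC; apply: (intro_closed (sym_connect_sym gC)) => x y gxy.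
case/bigcupP => C CP xC; apply/bigcupP; exists C => //.
have /imsetP[z _ def_C] := PC _ CP; move: xC; rewrite def_C !inE.
by move=> /connect_trans; apply; apply: connect1.
Qed.

Lemma leq_card_components_cover g P :
    simple_graph g -> acyclic g -> P \subset components g ->
  #|P| + #|edges_within g (cover P)| <= #|cover P|.
Proof.
move=> sg acg /subsetP PC.
apply: leq_trans (leq_card_components_meeting (cover P) sg acg).
rewrite leq_add2r; apply/subset_leq_card/subsetP => C CP; rewrite inE PC //=.
have /imsetP[x _ def_C] := PC _ CP; rewrite (setIidPl (bigcup_sup C CP)).
by apply/set0Pn; exists x; rewrite def_C component_refl.
Qed.

Section DeletedEdges.

Variables (g : rel V) (F P : {set {set V}}).
Hypotheses (sg : simple_graph g) (acg : acyclic g) (FE : F \subset edges g).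
Hypothesis PC : P \subset components (del_edges g F).

Let h := del_edges g F.

Lemma sum_degree_cover_components :
  \sum_(x in cover P) degree g x
    = \sum_(f in F) #|f :&: cover P| + 2 * #|edges_within h (cover P)|.
Proof.
have sh := simple_del_edges F sg; have [hC _] := sh.
have clP := closed_cover_components hC PC.
rewrite -(sum_degree_closed sh clP) !sum_degree // edges_del_edges.
by rewrite (big_setID F) (setIidPr FE).
Qed.

Let leq_card_edges_within_cover :
  #|P| + #|edges_within h (cover P)| <= #|cover P|.
Proof.
apply: leq_card_components_cover PC; first exact: simple_del_edges.
exact: acyclic_del_edges.
Qed.

Lemma leq_sum_degree_edge_ends :
  \sum_(x in cover P) degree g x + 2 * #|P|
    <= \sum_(f in F) #|f :&: cover P| + 2 * #|cover P|.
Proof.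
have := leq_card_edges_within_cover.
by rewrite sum_degree_cover_components; lia.
Qed.

Lemma leq_sum_degree_incident_edges :
  \sum_(x in cover P) degree g x + #|P|
    <= #|[set f in F | f :&: cover P != set0]| + 2 * #|cover P|.
Proof.
have := leq_card_edges_within_cover.
have := leq_card_components_meeting (cover P) sg acg.
rewrite (card_edges_within_del_edges _ FE) sum_degree_cover_components -/h.
suff : \sum_(f in F) #|f :&: cover P| <= #|[set f in F | f \subset cover P]|
    + #|[set f in F | f :&: cover P != set0]| by lia.
rewrite -!sum1dep_card !big_mkcondr -big_split; apply: leq_sum => f fF /=.
have f2 := card_edge sg (subsetP FE _ fF).
have [fP|nfP] := boolP (f \subset cover P).
  by rewrite (setIidPl fP) f2 -cards_eq0 f2.
have [->|_] := eqVneq (f :&: cover P) set0; first by rewrite cards0.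
by rewrite -ltnS -f2 proper_card // properE subsetIl subsetI subxx.
Qed.

End DeletedEdges.

Section AvoidingComponents.

Variables (g : rel V) (F : {set {set V}}) (L : {set V}).
Hypotheses (sg : simple_graph g) (acg : acyclic g) (FE : F \subset edges g).
Hypothesis degL : forall x, x \notin L -> 2 < degree g x.

Let bad := components_avoiding (del_edges g F) L.

Let badL : [disjoint cover bad & L].
Proof. exact: disjoint_cover_components_avoiding. Qed.

Let bad_components : bad \subset components (del_edges g F).
Proof. by rewrite /bad /components_avoiding setIdE subsetIl. Qed.

Let leq_card_bad_cover : #|bad| <= #|cover bad|.
Proof.
apply: leq_trans (leq_addr _ _) (leq_card_components_cover _ _ bad_components).
  exact: simple_del_edges.
exact: acyclic_del_edges.
Qed.

Let leq_sum_degree_bad : 3 * #|cover bad| <= \sum_(x in cover bad) degree g x.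
Proof.
rewrite mulnC -sum_nat_const; apply: leq_sum => x x_bad.
by rewrite degL // (disjointFr badL x_bad).
Qed.

Let leq_card_edgeI_bad f : f \in F -> #|f :&: cover bad| <= 2 - #|f :&: L|.
Proof.
move=> fF; rewrite -(card_edge sg (subsetP FE _ fF)) -cardsD.
by apply/subset_leq_card; rewrite setDE setIS -?disjoints_subset.
Qed.

Lemma leq_card_components_avoiding_ends :
  3 * #|bad| <= \sum_(f in F) (2 - #|f :&: L|).
Proof.
have : \sum_(f in F) #|f :&: cover bad| <= \sum_(f in F) (2 - #|f :&: L|).
  exact: leq_sum.
by have := leq_sum_degree_edge_ends sg acg FE bad_components; lia.
Qed.

Lemma leq_card_components_avoiding_incident :
  2 * #|bad| <= \sum_(f in F) (#|f :&: L| < 2).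
Proof.
have : #|[set f in F | f :&: cover bad != set0]|
    <= \sum_(f in F) (#|f :&: L| < 2).
  rewrite -sum1dep_card big_mkcondr; apply: leq_sum => f /leq_card_edgeI_bad.
  by rewrite -card_gt0; case: ifP => //; lia.
by have := leq_sum_degree_incident_edges sg acg FE bad_components; lia.
Qed.

End AvoidingComponents.

End Graphs.

Lemma sum_setU_levels (I : finType) (A0 A1 A2 : {set I}) (level : I -> nat)
    (w : nat -> nat) :
    (forall i, i \in A0 -> level i = 0%N) ->
    (forall i, i \in A1 -> level i = 1%N) ->
    (forall i, i \in A2 -> level i = 2%N) ->
  (\sum_(i in A0 :|: A1 :|: A2) w (level i)
     = #|A0| * w 0 + #|A1| * w 1 + #|A2| * w 2)%N.
Proof.
move=> lev0 lev1 lev2.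
have disj01 : [disjoint A0 & A1].
  by apply/pred0P => i /=; apply/negP => /andP[/lev0 + /lev1] => ->.
have disj012 : [disjoint A0 :|: A1 & A2].
  apply/pred0P => i /=; apply/negP => /andP[+ /lev2 i2].
  by rewrite inE => /orP[/lev0|/lev1]; rewrite i2.
have sum_level c (A : {set I}) : (forall i, i \in A -> level i = c) ->
    (\sum_(i in A) w (level i) = #|A| * w c)%N.
  by move=> levA; rewrite -sum_nat_const; apply: eq_bigr => i /levA->.
under eq_bigl do rewrite in_setU.
rewrite bigU //=; under eq_bigl do rewrite in_setU.
rewrite bigU //=.
by rewrite (sum_level _ _ lev0) (sum_level _ _ lev1) (sum_level _ _ lev2).
Qed.

Lemma le_interpolation (R : realFieldType) (b x y k : R) :
    3 * b <= 2 * x + y -> 2 * b <= x + y -> 3^-1 <= k -> k <= 2^-1 ->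
  b <= (1 - k) * x + k * y.
Proof.
move=> le_3b le_2b k_ge k_le.
have w3_ge0 : 0 <= 1 - 2 * k by lra.
have w2_ge0 : 0 <= 3 * k - 1 by lra.
have := lerD (ler_wpM2l w3_ge0 le_3b) (ler_wpM2l w2_ge0 le_2b).
by lra.
Qed.

Theorem lemma4p2 (V : finType) (T : rel V) (E0 E1 E2 : {set {set V}})
    (R : realFieldType) (k : R) :
  tree T ->
  E0 \subset edges T -> E1 \subset edges T -> E2 \subset edges T ->
  (forall f, f \in E0 -> #|f :&: low_degree T| = 0%N) ->
  (forall f, f \in E1 -> #|f :&: low_degree T| = 1%N) ->
  (forall f, f \in E2 -> #|f :&: low_degree T| = 2%N) ->
  3^-1 <= k -> k <= 2^-1 ->
  1 + k * #|E0|%:R + (1 - k) * #|E1|%:R + #|E2|%:R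
    <= #|[set C in components (del_edges T (E0 :|: E1 :|: E2))
            | C :&: low_degree T != set0]|%:R.
Proof.
move=> treeT sE0 sE1 sE2 low0 low1 low2 k_ge k_le; have [sT _ acT] := treeT.
set L := low_degree T; set F := _ :|: E2; set h := del_edges T F.
rewrite -/(components_meeting h L); set bad := components_avoiding h L.
have FE : F \subset edges T by rewrite !subUset sE0 sE1.
have degL x : x \notin L -> (2 < degree T x)%N by rewrite inE -ltnNge.
have sum_low w := sum_setU_levels w low0 low1 low2.
have cardF : #|F| = (#|E0| + #|E1| + #|E2|)%N.
  by rewrite -sum1_card (sum_low (fun=> 1%N)) !muln1.
have ends : (3 * #|bad| <= 2 * #|E0| + #|E1|)%N.
  apply: leq_trans (leq_card_components_avoiding_ends sT acT FE degL) _.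
  by rewrite (sum_low (fun i => 2 - i)%N); lia.
have incident : (2 * #|bad| <= #|E0| + #|E1|)%N.
  apply: leq_trans (leq_card_components_avoiding_incident sT acT FE degL) _.
  by rewrite (sum_low (fun i => i < 2)%N); lia.
have comps : (1 + #|F| <= #|components_meeting h L| + #|bad|)%N.
  rewrite card_components_meeting_avoiding.
  exact: ltn_card_components_tree_del_edges.
move: ends incident comps; rewrite cardF -!(ler_nat R) !(natrM, natrD).
by move=> ends /(le_interpolation ends)/(_ k_ge k_le); lra.
Qed.
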